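(* Let $p>3$ be a prime and let $G=\langle a_1,a_2,a_3\mid [a_2,a_1]=a_3\rangle$ (with the trivial relations omitted). Then the automorphism group of $G$ consists exactly of the maps $\alpha(u_1,u_2,u_3,v_1,v_2,v_3)$ determined by $$a_1\mapsto a_1^{u_1}a_2^{u_2}a_3^{u_3},\qquad a_2\mapsto a_1^{v_1}a_2^{v_2}a_3^{v_3},\qquad a_3\mapsto a_3^{u_1v_2-v_1u_2},$$ where $u_1,u_2,u_3,v_1,v_2,v_3\in\{0,\dots,p-1\}$ and $u_1v_2-v_1u_2\neq 0$ in $\mathbb F_p$.
   Context: $[h,g]=h^{-1}g^{-1}hg$. Presentation convention: $G$ is defined by the power-commutator presentation with the displayed relation together with all omitted trivial relations, here $a_1^p=a_2^p=a_3^p=1$ and $[a_3,a_1]=[a_3,a_2]=1$. So $G$ has order $p^3$. The parameters are regarded as elements of $\mathbb F_p$. *)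

(* Defs.v *)
From mathcomp Require Import all_boot all_order all_algebra all_fingroup.

Set Implicit Arguments.
Unset Strict Implicit.
Unset Printing Implicit Defensive.

Local Open Scope group_scope.

(* [~ x, y] is x^-1 * y^-1 * x * y (via x^-1 * x ^ y).

   [G \isog Grp (...)] determines G only up to isomorphism, so the
   named generators are given by the first two clauses.  A finite group is
   Hopfian, hence any generating triple satisfying the relations is the image
   of the formal generators under an isomorphism. *)
Definition presented_by (p : nat) (gT : finGroupType) (G : {group gT})
    (a1 a2 a3 : gT) : Prop :=
  [/\ G :=: <<[set a1; a2; a3]>>,
      [/\ [~ a2, a1] = a3,
          a1 ^+ p = 1, a2 ^+ p = 1 & a3 ^+ p = 1] /\
      ([~ a3, a1] = 1 /\ [~ a3, a2] = 1) &
      G \isog Grp (x1 : x2 : x3 :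
        ([~ x2, x1] = x3, x1 ^+ p, x2 ^+ p, x3 ^+ p,
         [~ x3, x1], [~ x3, x2]))].

(* The exponents are elements of 'F_p, coerced to their representatives in
   {0, ..., p-1}; the exponent of a3 in the last clause is computed in 'F_p. *)
Definition alpha_images (p : nat) (gT : finGroupType) (a1 a2 a3 : gT)
    (u1 u2 u3 v1 v2 v3 : 'F_p) (f : gT -> gT) : Prop :=
  [/\ f a1 = a1 ^+ u1 * a2 ^+ u2 * a3 ^+ u3,
      f a2 = a1 ^+ v1 * a2 ^+ v2 * a3 ^+ v3 &
      f a3 = a3 ^+ (u1 * v2 - v1 * u2)%R].

(* Main.v *)
Require Import Defs.
From mathcomp Require Import all_boot all_order all_algebra all_fingroup.
From mathcomp Require Import all_solvable ring.

Local Open Scope group_scope.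

(** In [G] the commutator [a3] of [a2] and [a1] is central, so every product of
    generators can be rewritten as [heis_elt i j k], that is
    [a1 ^+ i * a2 ^+ j * a3 ^+ k] with exponents in ['F_p], and these words
    multiply by the Heisenberg law [heis_eltM]:
      (i, j, k) (i', j', k') = (i + i', j + j', k + k' + j i').
    The power formula [heis_eltX] and the commutator formula [heis_elt_comm]
    follow from it; the latter is where the determinant u1 v2 - v1 u2 appears.

    An automorphism sends [a1] and [a2] to words with some exponents (u1, u2, u3)
    and (v1, v2, v3), hence sends [a3 = [~ a2, a1]] to [a3] raised to the
    determinant.  This power is nontrivial because [a3 != 1], which is seen in
    the extraspecial quotient [p^{1+2}] of [G] ([presented_a3_neq1]).

    Conversely, for any exponents the proposed images satisfy the defining
    relations ([heis_rel_images]): they have exponent [p] because the quadratic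
    term of the power formula carries the binomial coefficient 'C(p, 2), a
    multiple of [p] for odd [p].  The presentation then supplies an endomorphism
    ([presented_morphism]).  When the determinant is nonzero the linear algebra
    over ['F_p] on the first two exponents can be inverted, so the images
    generate [G] ([heis_gen_images]) and the endomorphism, being onto a finite
    group, is an automorphism. *)

Section Heisenberg.

Set Implicit Arguments.
Unset Strict Implicit.
Import GRing.Theory.

Implicit Types gT rT : finGroupType.

Definition heis_rel (p : nat) gT (a1 a2 a3 : gT) : Prop :=
  [/\ [~ a2, a1] = a3, a1 ^+ p = 1, a2 ^+ p = 1 & a3 ^+ p = 1] /\
  ([~ a3, a1] = 1 /\ [~ a3, a2] = 1).

(** The homomorphic images described by the presentation, with the generators
    named. *)
Lemma homGrp_heisP p rT (H : {group rT}) :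
  reflect (exists a1 a2 a3 : rT,
             H :=: <<[set a1; a2; a3]>> /\ heis_rel p a1 a2 a3)
    (H \homg Grp (x1 : x2 : x3 :
        ([~ x2, x1] = x3, x1 ^+ p, x2 ^+ p, x3 ^+ p,
         [~ x3, x1], [~ x3, x2]))).
Proof.
have genE (a1 a2 a3 : rT) :
    <[a1]> <*> <[a2]> <*> <[a3]> = <<[set a1; a2; a3]>>.
  have genU (A B : {set rT}) : <<A>> <*> <<B>> = <<A :|: B>>.
    by rewrite joing_idl joing_idr.
  by rewrite /cycle !genU.
apply: (iffP existsP) => [[[[a1 a2] a3]] | [a1 [a2 [a3]]]] /=.
  rewrite !xpair_eqE genE => /andP[/eqP <-] rels.
  exists a1, a2, a3; split=> //; move: rels.
  do 5![case/andP => /eqP ?]; move=> /eqP ?; by split.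
case=> defH [[r1 r2 r3 r4] [r5 r6]]; exists (a1, a2, a3).
by rewrite /= !xpair_eqE genE -defH r1 r2 r3 r4 r5 r6 !eqxx.
Qed.

(** ** Normal forms and the Heisenberg multiplication law *)

Section NormalForm.

Variables (p : nat) (p_pr : prime p) (gT : finGroupType) (a1 a2 a3 : gT).
Hypothesis rels : heis_rel p a1 a2 a3.

Definition heis_elt (i j k : 'F_p) : gT := a1 ^+ i * a2 ^+ j * a3 ^+ k.

Lemma val_F1 : (1%R : 'F_p) = 1%N :> nat.
Proof. by rewrite /= modn_small ?pdiv_gt1. Qed.

Lemma expgF_nat x n : x ^+ p = 1 :> gT -> x ^+ (n%:R : 'F_p)%R = x ^+ n.
Proof. by move=> xp; rewrite val_Fp_nat // expg_mod. Qed.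

Lemma expgF_D (x : gT) (i j : 'F_p) :
  x ^+ p = 1 -> x ^+ (i + j)%R = x ^+ i * x ^+ j.
Proof.
move=> xp; rewrite -{1}[i]natr_Zp -{1}[j]natr_Zp -natrD.
by rewrite expgF_nat // expgD.
Qed.

Lemma expgF_M (x : gT) (i j : 'F_p) :
  x ^+ p = 1 -> x ^+ (i * j)%R = x ^+ (i * j)%N.
Proof.
by move=> xp; rewrite -{1}[i]natr_Zp -{1}[j]natr_Zp -natrM expgF_nat.
Qed.

(** Moving [a2 ^+ j] past [a1 ^+ i'] costs the central factor
    [a3 ^+ (j * i')]; everything else commutes. *)
Lemma heis_eltM i j k i' j' k' :
  heis_elt i j k * heis_elt i' j' k' =
  heis_elt (i + i')%R (j + j')%R (k + k' + j * i')%R.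
Proof.
case: rels => [[r21 a1p a2p a3p] [/eqP/commgP c31 /eqP/commgP c32]].
rewrite /heis_elt !expgF_D // expgF_M //.
have c3 n (m : nat) : commute (a3 ^+ n) (a1 ^+ m) by apply: commuteX2.
have c3' n (m : nat) : commute (a3 ^+ n) (a2 ^+ m) by apply: commuteX2.
have swap (m n : nat) : a2 ^+ m * a1 ^+ n = a1 ^+ n * a2 ^+ m * a3 ^+ (m * n).
  rewrite commgC; congr (_ * _); rewrite commXXg r21 //; exact/commute_sym.
have -> : a1 ^+ i * a2 ^+ j * a3 ^+ k * (a1 ^+ i' * a2 ^+ j' * a3 ^+ k')
    = a1 ^+ i * (a2 ^+ j * (a3 ^+ k * a1 ^+ i') * a2 ^+ j') * a3 ^+ k'.
  by rewrite !mulgA.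
rewrite c3 (mulgA (a2 ^+ j)) swap -(mulgA _ (a3 ^+ (j * i'))) -expgD.
rewrite -(mulgA _ _ (a2 ^+ j')) c3' -!mulgA -!expgD.
by rewrite (addnA k) (addnC (k + k')) addnA.
Qed.

Lemma heis_elt0 : heis_elt 0%R 0%R 0%R = 1.
Proof. by rewrite /heis_elt !mulg1. Qed.

Lemma heis_eltX i j k n :
  heis_elt i j k ^+ n =
  heis_elt (i *+ n)%R (j *+ n)%R (k *+ n + (i * j) *+ 'C(n, 2))%R.
Proof.
elim: n => [|n IHn]; first by rewrite expg0 !mulr0n addr0 heis_elt0.
rewrite expgSr IHn heis_eltM !mulrSr binS bin1 mulrnDr.
congr heis_elt; rewrite -mulrnAl; ring.
Qed.

(** By [commgC] the commutator is the discrepancy between the two products,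
    whose last exponents carry the cross terms [v2 * u1] and [u2 * v1]. *)
Lemma heis_elt_comm u1 u2 u3 v1 v2 v3 :
  [~ heis_elt v1 v2 v3, heis_elt u1 u2 u3] = a3 ^+ (u1 * v2 - v1 * u2)%R.
Proof.
have a3E (d : 'F_p) : a3 ^+ d = heis_elt 0%R 0%R d by rewrite /heis_elt !mul1g.
rewrite a3E; apply: (mulgI (heis_elt u1 u2 u3 * heis_elt v1 v2 v3)).
by rewrite -commgC !heis_eltM; congr heis_elt; ring.
Qed.

(** By the multiplication law the normal forms are closed under products, so
    they make up a (finite) group, and it contains the generators. *)
Lemma mem_heis_gen x :
  x \in <<[set a1; a2; a3]>> -> exists i j k, x = heis_elt i j k.
Proof.
move: x; pose N := [set heis_elt ijk.1.1 ijk.1.2 ijk.2 | ijk : 'F_p * 'F_p * 'F_p].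
have memN i j k : heis_elt i j k \in N by apply/imsetP; exists (i, j, k).
have gN : group_set N.
  apply/group_setP; split; first by rewrite -heis_elt0.
  by move=> _ _ /imsetP[y _ ->] /imsetP[z _ ->]; rewrite heis_eltM.
suff sN : <<[set a1; a2; a3]>> \subset N.
  by move=> x /(subsetP sN)/imsetP[[[i j] k] _ ->]; exists i, j, k.
rewrite -(gen_set_id gN); apply/genS/subsetP=> y; rewrite !inE.
case/orP=> [/orP[]|] /eqP->.
- by have := memN 1%R 0%R 0%R; rewrite /heis_elt val_F1 !mulg1.
- by have := memN 0%R 1%R 0%R; rewrite /heis_elt val_F1 mulg1 mul1g.
by have := memN 0%R 0%R 1%R; rewrite /heis_elt val_F1 !mul1g.
Qed.

(** For odd [p] the binomial coefficient in [heis_eltX] vanishes modulo [p]. *)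
Lemma heis_elt_expp : 2 < p -> forall i j k, heis_elt i j k ^+ p = 1.
Proof.
move=> p_gt2 i j k; have chp := pchar_Fp p_pr.
have /dvdnP[m Cp2] : p %| 'C(p, 2) by rewrite prime_dvd_bin.
by rewrite heis_eltX Cp2 mulrnA !(mulrn_pchar chp) addr0 heis_elt0.
Qed.

Lemma heis_rel_images : 2 < p -> forall u1 u2 u3 v1 v2 v3,
  heis_rel p (heis_elt u1 u2 u3) (heis_elt v1 v2 v3)
    (a3 ^+ (u1 * v2 - v1 * u2)%R).
Proof.
move=> p_gt2 u1 u2 u3 v1 v2 v3; rewrite -(heis_elt_comm _ _ u3 _ _ v3).
have comm3 d i j k : [~ a3 ^+ nat_of_ord (d : 'F_p), heis_elt i j k] = 1.
  have -> : a3 ^+ d = heis_elt 0%R 0%R d by rewrite /heis_elt !mul1g.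
  by rewrite heis_elt_comm mulr0 mul0r subr0 expg0.
do 2?split; rewrite ?heis_elt_expp // heis_elt_comm ?comm3 //.
case: rels => [[_ _ _ a3p] _].
by rewrite -expgM mulnC expgM a3p expg1n.
Qed.

(** The subgroup [H] generated by the images contains [a3], a power of
    [a3 ^+ d].  Whether a normal form lies in [H] therefore depends only on its
    first two exponents, and the admissible pairs [(i, j)] form a subspace of
    the plane over ['F_p].  It contains two vectors of determinant [d != 0], so
    it contains the standard basis. *)
Lemma heis_gen_images (u1 u2 u3 v1 v2 v3 : 'F_p) (d := (u1 * v2 - v1 * u2)%R) :
  d != 0%R ->
  <<[set heis_elt u1 u2 u3; heis_elt v1 v2 v3; a3 ^+ d]>>
    = <<[set a1; a2; a3]>>.
Proof.
move=> nz_d; case: (rels) => [[_ a1p a2p a3p] _].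
have sub3 (a b c : gT) (K : {group gT}) :
    ([set a; b; c] \subset K) = [&& a \in K, b \in K & c \in K].
  by rewrite !subUset !sub1set -andbA.
apply/eqP; rewrite eqEsubset !gen_subG !sub3 /heis_elt.
have [A1 A2 A3] : [/\ a1 \in <<[set a1; a2; a3]>>, a2 \in <<[set a1; a2; a3]>>
                   & a3 \in <<[set a1; a2; a3]>>].
  by rewrite !mem_gen ?inE ?eqxx ?orbT.
rewrite !(groupM, groupX) //=.
set b1 := _ * _ * _; set b2 := _ * _ * _.
pose H := <<[set b1; b2; a3 ^+ d]>>%G.
have [B1 B2 B3] : [/\ b1 \in H, b2 \in H & a3 ^+ d \in H].
  by rewrite !mem_gen ?inE ?eqxx ?orbT.
have H3 : a3 \in H.
  have -> : a3 = (a3 ^+ d) ^+ (d^-1 : 'F_p)%R.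
    by rewrite -expgM -expgF_M // mulfV // val_F1.
  exact: groupX.
pose P i j := a1 ^+ nat_of_ord (i : 'F_p) * a2 ^+ nat_of_ord (j : 'F_p) \in H.
have PE i j k : (heis_elt i j k \in H) = P i j by rewrite groupMr ?groupX.
have PD i j i' j' : P i j -> P i' j' -> P (i + i')%R (j + j')%R.
  rewrite -!(PE _ _ 0%R) => Hx Hy; have := groupM Hx Hy.
  by rewrite heis_eltM !PE.
have PZ c i j : P i j -> P (c * i)%R (c * j)%R.
  rewrite -[c]natr_Zp !mulr_natl => Pij.
  by have := groupX c (etrans (PE i j 0%R) Pij); rewrite heis_eltX PE.
have P1 : P u1 u2 by rewrite -(PE _ _ u3).
have P2 : P v1 v2 by rewrite -(PE _ _ v3).
(* Cramer's rule expresses the standard basis in the rows of the matrix. *)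
have Q1 : P 1%R 0%R.
  have := PZ d^-1%R _ _ (PD _ _ _ _ (PZ v2 _ _ P1) (PZ (- u2)%R _ _ P2)).
  congr P; last ring.
  by rewrite -[RHS](mulVf nz_d) /d; ring.
have Q2 : P 0%R 1%R.
  have := PZ d^-1%R _ _ (PD _ _ _ _ (PZ (- v1)%R _ _ P1) (PZ u1 _ _ P2)).
  congr P; first ring.
  by rewrite -[RHS](mulVf nz_d) /d; ring.
by apply/and3P; move: Q1 Q2; rewrite /P val_F1 mulg1 mul1g.
Qed.

End NormalForm.

(** ** Consequences of the presentation *)

(** Von Dyck's theorem with the generators named.  The subgroup [H] of the direct
    product generated by the pairs [(ai, bi)] satisfies the relations, so it is
    a homomorphic image of [G] and has at most as many elements; since it also
    projects onto [G], this projection is injective and [H] is the graph of a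
    morphism. *)
Lemma presented_morphism p gT (G : {group gT}) (a1 a2 a3 : gT) rT
    (b1 b2 b3 : rT) :
  presented_by p G a1 a2 a3 -> heis_rel p b1 b2 b3 ->
  exists f : {morphism G >-> rT}, [/\ f a1 = b1, f a2 = b2 & f a3 = b3].
Proof.
case=> defG relA isoG relB.
pose c1 := (a1, b1); pose c2 := (a2, b2); pose c3 := (a3, b3).
pose H := <<[set c1; c2; c3]>>%G.
have [C1 C2 C3] : [/\ c1 \in H, c2 \in H & c3 \in H].
  by rewrite !mem_gen ?inE ?eqxx ?orbT.
have relC : heis_rel p c1 c2 c3.
  have pairX (x : gT) (y : rT) n : (x, y) ^+ n = (x ^+ n, y ^+ n).
    by elim: n => // n IHn; rewrite !expgS IHn.
  have pairR (x x' : gT) (y y' : rT) :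
    [~ (x, y), (x', y')] = ([~ x, x'], [~ y, y']) by [].
  case: relA relB => [[A0 A1 A2 A3] [A4 A5]] [[B0 B1 B2 B3] [B4 B5]].
  by rewrite /heis_rel /c1 /c2 /c3 !pairX !pairR A0 A1 A2 A3 A4 A5
             B0 B1 B2 B3 B4 B5.
have leHG : #|H| <= #|G|.
  by apply/leq_homg; rewrite isoG; apply/homGrp_heisP; exists c1, c2, c3.
pose pr1 := restrm (subsetT H) (@fst_morphism gT rT).
have im1 : pr1 @* H = G.
  rewrite morphim_restrm setIid morphim_gen ?subsetT // defG; congr <<_>>.
  by rewrite !morphimU !morphim_set1 ?inE.
have inj1 : 'injm pr1 by rewrite -card_im_injm eqn_leq leq_morphim im1.
pose f x := (invm inj1 x).2.
have fM : {in G &, {morph f : x y / x * y}}.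
  by rewrite -im1 => x y imx imy; rewrite /f morphM.
have fE c : c \in H -> f c.1 = c.2.
  by move=> Hc; rewrite /f (_ : c.1 = pr1 c) ?invmE.
exists (Morphism fM).
by split; [apply: (fE c1) | apply: (fE c2) | apply: (fE c3)].
Qed.

(** The relations hold in the nonabelian group [p^{1+2}], which is generated by
    two elements [x], [y]; a morphism there maps [a3] to [[~ x, y]], and this
    would be trivial if [a3] were. *)
Lemma presented_a3_neq1 p gT (G : {group gT}) (a1 a2 a3 : gT) :
  prime p -> presented_by p G a1 a2 a3 -> a3 != 1.
Proof.
move=> p_pr presG; have [defG [[r1 _ _ _] _] _] := presG.
case/existsP: (isoGrp_hom (Grp_pX1p2 p_pr)) => [[x y]] /=.
rewrite !xpair_eqE => /and5P[/eqP defE /eqP xp /eqP yp /eqP czx /eqP czy].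
have zp : [~ x, y] ^+ p = 1.
  by rewrite -commXg ?xp ?comm1g //; apply/commute_sym/commgP/eqP.
have relE : heis_rel p y x [~ x, y] by [].
have [f [f1 f2 f3]] := presented_morphism presG relE.
apply/eqP=> a31; have cxy : commute x y.
  by apply/commgP; rewrite -f3 a31 morph1.
have : abelian (<[x]> <*> <[y]>).
  by rewrite abelianY !cycle_abelian; apply: cents_cycle.
rewrite defE; apply/negP.
exact: extraspecial_nonabelian (pX1p2_extraspecial p_pr).
Qed.

End Heisenberg.

(** ** The automorphisms *)

Theorem mainTheorem5 (p : nat) (p_prime : prime p) (p_gt3 : (3 < p)%N)
    (gT : finGroupType) (G : {group gT}) (a1 a2 a3 : gT)
    (presG : presented_by p G a1 a2 a3) :
  (forall u1 u2 u3 v1 v2 v3 : 'F_p, (u1 * v2 - v1 * u2 != 0)%R ->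
     exists phi : {perm gT},
       [/\ phi \in Aut G,
           alpha_images a1 a2 a3 u1 u2 u3 v1 v2 v3 phi &
           forall f : {morphism G >-> gT},
             alpha_images a1 a2 a3 u1 u2 u3 v1 v2 v3 f -> {in G, f =1 phi}])
  /\
  (forall phi : {perm gT}, phi \in Aut G ->
     exists u1 u2 u3 v1 v2 v3 : 'F_p,
       (u1 * v2 - v1 * u2 != 0)%R /\
       alpha_images a1 a2 a3 u1 u2 u3 v1 v2 v3 phi).
Proof.
have [defG rels _] := presG; have p_gt2 := ltnW p_gt3.
have [A1 A2 A3] : [/\ a1 \in G, a2 \in G & a3 \in G].
  by rewrite defG !mem_gen ?inE ?eqxx ?orbT.
split=> [u1 u2 u3 v1 v2 v3 nz_d | phi Aphi].
  have relB := heis_rel_images p_prime rels p_gt2 u1 u2 u3 v1 v2 v3.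
  have [f [f1 f2 f3]] := presented_morphism presG relB.
  have imf : f @* G = G.
    suff: f @* <<[set a1; a2; a3]>> = <<[set a1; a2; a3]>> by rewrite -defG.
    rewrite morphim_gen; last by rewrite -gen_subG -defG.
    rewrite !morphimU !morphim_set1 // f1 f2 f3.
    exact: heis_gen_images.
  have injf : 'injm f by rewrite -card_im_injm imf.
  exists (aut injf imf); split; rewrite ?Aut_aut //.
    by split; rewrite autE // ?f1 ?f2 ?f3.
  move=> g [g1 g2 g3] x Gx; rewrite autE //.
  have [] := @mem_heis_gen _ p_prime _ _ _ _ rels x; first by rewrite -defG.
  move=> i [j [k ->]].
  rewrite /heis_elt !(morphM, morphX) ?(groupM, groupX) //.
  by rewrite f1 f2 f3 g1 g2 g3.
have phiG x : x \in G -> phi x \in <<[set a1; a2; a3]>>.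
  by move=> Gx; rewrite -defG Aut_closed.
have [u1 [u2 [u3 E1]]] := mem_heis_gen p_prime rels (phiG _ A1).
have [v1 [v2 [v3 E2]]] := mem_heis_gen p_prime rels (phiG _ A2).
exists u1, u2, u3, v1, v2, v3.
have E3 : phi a3 = a3 ^+ (u1 * v2 - v1 * u2)%R.
  rewrite -(heis_elt_comm p_prime rels _ _ u3 _ _ v3) -E1 -E2.
  by have [[r21 _ _ _] _] := rels; rewrite -!(autmE Aphi) -morphR ?r21.
split=> //; apply/eqP=> d0.
have := presented_a3_neq1 p_prime presG; rewrite -(inj_eq (@perm_inj _ phi)).
by rewrite E3 d0 expg0 -(autmE Aphi) morph1 eqxx.
Qed.
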